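(* Let $\mu,\nu$ be probability measures on $\mathbb{R}$, let $(X_k)_{k\ge1}$ be i.i.d. with law $\mu$, and $(W_j)_{j\ge1}$ i.i.d. with law $\nu$, independent of $(X_k)$. Fix an integer $M>0$ and set $Y_{(k-1)M+i}:=X_k+W_{(k-1)M+i}$ for $i=1,\dots,M$, $k=1,2,\dots$. Let $(B_n)$ be Borel subsets of $\mathbb{R}$ and $\tau\ge 0$, and assume $$\lim_{n\to\infty}\sup_{x\in\mathbb{R}}\nu(B_n+x)=0\qquad\text{and}\qquad\lim_{n\to\infty}n\,(\mu*\nu)(B_n)=\tau.$$ Then $$\lim_{n\to\infty}\mathbb{P}\big(Y_i\notin B_{nM}\text{ for }i=1,2,\dots,nM\big)=e^{-\tau}.$$
   Context: $\mu*\nu$ denotes the convolution of the measures (the law of $X_1+W_1$), and $B_n+x:=\{b+x: b\in B_n\}$. *)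

(* Defs.v *)
From HB Require Import structures.
From mathcomp Require Import all_boot all_order all_algebra.
From mathcomp Require Import all_classical all_reals all_analysis.
Set Implicit Arguments. Unset Strict Implicit. Unset Printing Implicit Defensive.
Import Order.TTheory GRing.Theory Num.Theory.
Local Open Scope classical_set_scope.
Local Open Scope ring_scope.

Definition mutually_independent d (T : measurableType d) (R : realType)
  (P : probability T R) (I : eqType) (Z : I -> {RV P >-> R}) : Prop :=
  forall (F : seq I), uniq F ->
  forall A : I -> set R, (forall i, measurable (A i)) ->
  P (\bigcap_(i in [set` F]) (Z i @^-1` A i)) =
  (\prod_(i <- F) P (Z i @^-1` A i))%E.

Definition has_law d (T : measurableType d) (R : realType)
  (P : probability T R) (Z : {RV P >-> R}) (mu : probability R R) : Prop :=
  forall A : set R, measurable A -> P (Z @^-1` A) = mu A.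

Definition convolution (R : realType) (mu nu : probability R R) (B : set R)
  : \bar R := (mu \x nu)%E [set p | p.1 + p.2 \in B].

(* Main.v *)
Require Import Defs.
From HB Require Import structures.
From mathcomp Require Import all_boot all_order all_algebra.
From mathcomp Require Import all_classical all_reals all_analysis.
From mathcomp Require Import measurable_realfun.
From mathcomp Require Import lra.
Set Implicit Arguments. Unset Strict Implicit. Unset Printing Implicit Defensive.
Import Order.TTheory GRing.Theory Num.Theory.
Import numFieldNormedType.Exports.
Local Open Scope classical_set_scope.
Local Open Scope ring_scope.

(* Given the X's, each Y_i misses D = B_{nM} with probability h(X_k), where
   h(x) = nu {y | x + y \notin D}; integrating the noise variables out one at a
   time shows that the n blocks avoid D with probability q^n, where
   q = \int h^M dmu.  Put g = 1 - h, p = \int g dmu = (mu * nu)(D) and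
   s = sup_x nu(D + x) >= g.  From 1 - M g <= (1 - g)^M <= 1 - M g + M^2 g^2 one
   gets M p (1 - M s) <= 1 - q <= M p, so n (1 - q) --> tau, whence
   q^n --> e^{-tau}. *)

(** * Integrating out an independent variable *)

(** The joint law of [(Z1, Z2)] agrees with the product of the law of [Z1] and [nu] on rectangles,
    hence everywhere; Tonelli then splits the integral. *)
Lemma ge0_integral_independent (R : realType) (d d1 d2 : measure_display)
  (T : measurableType d) (T1 : measurableType d1) (T2 : measurableType d2)
  (P : probability T R) (nu : probability T2 R)
  (Z1 : {RV P >-> T1}) (Z2 : T -> T2) (mZ2 : measurable_fun setT Z2) :
  (forall A B, measurable A -> measurable B ->
    P (Z1 @^-1` A `&` Z2 @^-1` B) = (P (Z1 @^-1` A) * nu B)%E) ->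
  forall f : T1 * T2 -> \bar R,
  measurable_fun setT f -> (forall x, (0 <= f x)%E) ->
  (\int[P]_w f (Z1 w, Z2 w) = \int[P]_w \int[nu]_y f (Z1 w, y))%E.
Proof.
move=> indep f mf f0.
have mZ : measurable_fun setT (fun w => (Z1 w, Z2 w)).
  exact: measurable_fun_pair.
pose m1 : probability T1 R := distribution P Z1.
transitivity (\int[(m1 \x nu)%E]_z f z)%E.
  rewrite (eq_measure_integral (pushforward P (fun w => (Z1 w, Z2 w)))); last first.
    move=> A mA _; apply: product_measure_unique => //; exact: indep.
  by rewrite (ge0_integral_pushforward mZ).
rewrite fubini_tonelli1// /m1 ge0_integral_distribution//.
- exact: measurable_fun_fubini_tonelli_F.
- by move=> y; apply: integral_ge0.
Qed.

(** As functions of [E], both sides are finite measures that agree on the pi-system [G], which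
    contains the whole space; so they agree on the sigma-algebra it generates. *)
Lemma sigma_algebra_independent (R : realType) (d : measure_display)
  (T : measurableType d) (P : probability T R) (G : set (set T)) (A : set T) :
  G `<=` measurable -> G setT -> setI_closed G -> measurable A ->
  (forall E, G E -> P (E `&` A) = (P E * P A)%E) ->
  forall E, <<s G >> E -> P (E `&` A) = (P E * P A)%E.
Proof.
move=> Gm GT GI mA indep E GE.
have PA0 : 0 <= fine (P A) by exact: fine_ge0.
pose m2 := mscale (NngNum PA0) P.
have m2E S : (P S * P A = m2 S)%E.
  by rewrite /m2 /mscale /= muleC fineK// fin_num_measure.
rewrite m2E.
apply: (@g_sigma_algebra_measure_unique _ _ _ G Gm (fun=> setT) _ _
  (mrestr P mA) m2) => //.
- by rewrite bigcup_const//; exists 0%N.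
- by move=> S GS; exact: (etrans (indep S GS) (m2E S)).
- move=> _; rewrite /= /mrestr setTI.
  by rewrite (le_lt_trans (probability_le1 _ _)) ?ltry.
Qed.

(** * The sigma-algebra generated by finitely many of the variables *)

Section rectangles.
Context (R : realType) (d : measure_display) (T : measurableType d)
  (P : probability T R) (I : eqType) (Z : I -> {RV P >-> R}).

(** A pi-system generating the sigma-algebra of the [Z i] with [i] in [S]. Sides are chosen for
    every index, as in [mutually_independent], but only those in [S] constrain the event. *)
Definition rectangles (S : seq I) : set (set T) :=
  [set E | exists2 A : I -> set R, (forall i, measurable (A i)) &
           E = \bigcap_(i in [set` S]) (Z i @^-1` A i)].

Lemma measurable_rectangles S : rectangles S `<=` measurable.
Proof.
move=> _ [A mA ->]; apply: fin_bigcap_measurable => // i _.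
by rewrite -[X in measurable X]setTI; exact: measurable_funPT.
Qed.

Lemma sigma_rectangles_preimage (S : seq I) (i : I) (A : set R) :
  i \in S -> measurable A -> <<s rectangles S >> (Z i @^-1` A).
Proof.
move=> iS mA; apply: sub_sigma_algebra.
exists (fun j => if j == i then A else setT) => [j|]; first by case: ifP.
apply/seteqP; split => [w Aw j /= _|w /(_ i iS)/=]; first by case: eqP => // ->.
by rewrite eqxx.
Qed.

Hypothesis indep : mutually_independent Z.

Lemma sigma_rectangles_independent (S : seq I) (j : I) (E : set T) (A : set R) :
  uniq S -> j \notin S -> <<s rectangles S >> E -> measurable A ->
  P (E `&` Z j @^-1` A) = (P E * P (Z j @^-1` A))%E.
Proof.
move=> uS jS SE mA; apply: sigma_algebra_independent SE.
- exact: measurable_rectangles.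
- by exists (fun=> setT) => //; apply/esym/seteqP; split.
- move=> _ _ [A1 mA1 ->] [A2 mA2 ->]; exists (fun i => A1 i `&` A2 i).
    by move=> i; exact: measurableI.
  by rewrite -bigcapI.
- by rewrite -[X in measurable X]setTI; exact: measurable_funPT.
- move=> _ [B mB ->].
  (* Putting [A] at index [j] makes the intersection a single rectangle over [j :: S]. Independence
     is used twice: on [j :: S] to split the product, and on [S] to fold the remaining factors
     back. *)
  pose B' i := if i == j then A else B i.
  have B'E i : i \in S -> B' i = B i.
    by rewrite /B'; case: eqP => // ->; rewrite (negPf jS).
  have B'j : B' j = A by rewrite /B' eqxx.
  have mB' i : measurable (B' i) by rewrite /B'; case: ifP.
  have := @indep (j :: S); rewrite /= jS => /(_ uS _ mB').
  have -> : [set` j :: S] = j |` [set` S].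
    apply/seteqP; split=> i /=; rewrite inE; first by case/predU1P; [left|right].
    by case=> [->|->]; rewrite ?eqxx ?orbT.
  rewrite big_cons bigcap_setU1 B'j setIC.
  rewrite (_ : \bigcap_(i in [set` S]) (Z i @^-1` B' i) =
               \bigcap_(i in [set` S]) (Z i @^-1` B i)) => [->|]; last first.
    by apply: eq_bigcapr => i /= /B'E ->.
  rewrite muleC; congr (_ * _)%E; rewrite indep//.
  by apply: eq_big_seq => i /B'E ->.
Qed.

(** The past is encoded as the sample point itself, in [T] with the coarser sigma-algebra:
    measurability of [f] then says that it sees [w] only through the variables in [S], and no random
    vector is needed. *)
Lemma ge0_integral_sigma_rectangles (nu : probability R R)
  (S : seq I) (j : I) (f : g_sigma_algebraType (rectangles S) * R -> \bar R) :
  uniq S -> j \notin S -> has_law (Z j) nu ->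
  measurable_fun setT f -> (forall x, (0 <= f x)%E) ->
  (\int[P]_w f (w, Z j w) = \int[P]_w \int[nu]_y f (w, y))%E.
Proof.
move=> uS jS Zj mf f0.
have mid : measurable_fun (setT : set T)
    (idfun : T -> g_sigma_algebraType (rectangles S)).
  move=> _ A mA; rewrite setTI.
  apply: (smallest_sub _ _ mA); last exact: measurable_rectangles.
  exact: sigma_algebra_measurable.
pose Z1 : {RV P >-> g_sigma_algebraType (rectangles S)} :=
  HB.pack_for {mfun T >-> g_sigma_algebraType (rectangles S)} idfun
    
    (isMeasurableFun.Build _ _ T (g_sigma_algebraType (rectangles S)) idfun mid).
apply: (@ge0_integral_independent _ _ _ _ _ _ _ P nu Z1) => //.
move=> A B mA mB; rewrite -Zj//.
exact: (@sigma_rectangles_independent S j A B).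
Qed.

End rectangles.

(** * The probability that the first n blocks avoid D *)

Section avoidance.
Context (R : realType) (d : measure_display) (T : measurableType d)
  (P : probability T R) (mu nu : probability R R) (X W : nat -> {RV P >-> R}).
Let Z (i : nat + nat) := match i with inl k => X k | inr j => W j end.
Hypotheses (HX : forall k, has_law (X k) mu) (HW : forall j, has_law (W j) nu)
  (indep : mutually_independent Z).
Context (M : nat) (M_gt0 : (0 < M)%N) (D : set R) (mD : measurable D).

(** Real-valued so that powers and differences stay in [R]; [fine] loses nothing, by
    [miss_probE]. *)
Definition miss_prob (x : R) : R := fine (nu [set y | (~` D) (x + y)]).

Lemma measurable_translate (x : R) (E : set R) :
  measurable E -> measurable [set y | E (x + y)].
Proof.
move=> mE; rewrite -[X in measurable X]setTI.
have : measurable_fun setT (fun y : R => x + y) by exact: measurable_funD.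
exact.
Qed.

Lemma miss_probE (x : R) : (miss_prob x)%:E = nu [set y | (~` D) (x + y)].
Proof.
rewrite fineK// fin_num_measure//; apply: measurable_translate.
exact: measurableC.
Qed.

Lemma miss_prob_ge0 (x : R) : 0 <= miss_prob x.
Proof. exact: fine_ge0. Qed.

Lemma measurable_miss_prob : measurable_fun setT miss_prob.
Proof.
apply: measurableT_comp => //.
pose C : set (R * R) := [set p | (~` D) (p.1 + p.2)].
have mC : measurable C.
  rewrite -[X in measurable X]setTI.
  have : measurable_fun setT (fun p : R * R => p.1 + p.2).
    by apply: measurable_funD; [exact: measurable_fst|exact: measurable_snd].
  by apply => //; exact: measurableC.
have := measurable_fun_xsection nu mC; apply: eq_measurable_fun => x _ /=.
by congr (nu _); rewrite /xsection; apply/seteqP; split=> y /=; rewrite inE.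
Qed.

(** Here [j] counts single sums, not blocks, so that the noise variables can be removed one by
    one. *)
Definition avoids (j : nat) : set T :=
  \bigcap_(i in `I_j) [set w | (~` D) (X (i %/ M)%N w + W i w)].

Definition past (k j : nat) : seq (nat + nat) :=
  map inl (iota 0 k) ++ map inr (iota 0 j).

Lemma inl_past k j i : (inl i \in past k j) = (i < k)%N.
Proof.
rewrite mem_cat mem_map ?mem_iota//; last by move=> ? ? [].
by case: mapP => [[?]//|_]; rewrite orbF.
Qed.

Lemma inr_past k j i : (inr i \in past k j) = (i < j)%N.
Proof.
rewrite mem_cat orbC mem_map ?mem_iota//; last by move=> ? ? [].
by case: mapP => [[?]//|_]; rewrite orbF.
Qed.

Lemma uniq_past k j : uniq (past k j).
Proof.
rewrite cat_uniq !map_inj_uniq ?iota_uniq ?andbT /=; try by move=> ? ? [].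
by apply/hasPn => _ /mapP[i _ ->]; apply/mapP => -[].
Qed.

Let sigma_past k j := g_sigma_algebraType (rectangles Z (past k j)).

Lemma measurable_past k j i : i \in past k j ->
  measurable_fun (setT : set (sigma_past k j)) (Z i : sigma_past k j -> R).
Proof.
by move=> ikj _ A mA; rewrite setTI; exact: sigma_rectangles_preimage.
Qed.

(** The bound on [j] ensures [i %/ M < k] for each [i < j], so only the first [k] of the [X]
    variables occur. *)
Lemma past_avoids k j : (j <= k * M)%N ->
  measurable (avoids j : set (sigma_past k j)).
Proof.
move=> jkM; apply: fin_bigcap_measurable => // i /= ij.
rewrite -[X in measurable X]setTI.
have mY : measurable_fun (setT : set (sigma_past k j))
    (fun w : sigma_past k j => X (i %/ M)%N w + W i w).
  apply: measurable_funD.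
    apply: (@measurable_past k j (inl (i %/ M)%N)).
    by rewrite inl_past ltn_divLR// (leq_trans ij).
  by apply: (@measurable_past k j (inr i)); rewrite inr_past.
exact: (mY measurableT _ (measurableC mD)).
Qed.

Lemma measurable_avoids j : measurable (avoids j).
Proof.
apply: fin_bigcap_measurable => // i /= ij; rewrite -[X in measurable X]setTI.
have mY : measurable_fun setT (fun w => X (i %/ M)%N w + W i w).
  exact: measurable_funD.
exact: (mY measurableT _ (measurableC mD)).
Qed.

Lemma indic_avoidsS j w : \1_(avoids j.+1) w =
  \1_(avoids j) w * \1_(~` D) (X (j %/ M)%N w + W j w) :> R.
Proof.
have -> : avoids j.+1 = avoids j `&` [set w | (~` D) (X (j %/ M)%N w + W j w)].
  by rewrite /avoids IIS bigcap_setU bigcap_set1.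
by rewrite indicI.
Qed.

(* [W j] is independent of the past, so integrating it out trades the event that
   the [j]-th sum misses [D] for one more factor [miss_prob]. *)
Lemma integrate_out_noise j m :
  (\int[P]_w (\1_(avoids j.+1) w * miss_prob (X (j %/ M)%N w) ^+ m)%:E =
   \int[P]_w (\1_(avoids j) w * miss_prob (X (j %/ M)%N w) ^+ m.+1)%:E)%E.
Proof.
(* With [k.+1] the past contains [X k], shared by the whole block, while [W j] stays outside it. *)
pose k := (j %/ M)%N; pose S := past k.+1 j.
pose f (p : sigma_past k.+1 j * R) : \bar R :=
  (\1_(avoids j) p.1 * miss_prob (X k p.1) ^+ m * \1_(~` D) (X k p.1 + p.2))%:E.
have jk : (j <= k.+1 * M)%N by rewrite ltnW// -ltn_divLR.
have mX : measurable_fun (setT : set (sigma_past k.+1 j))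
    (X k : sigma_past k.+1 j -> R).
  by apply: (@measurable_past k.+1 j (inl k)); rewrite inl_past.
have mI : measurable_fun (setT : set (sigma_past k.+1 j))
    (\1_(avoids j) : sigma_past k.+1 j -> R).
  exact: measurable_indic (past_avoids jk).
have mf : measurable_fun setT f.
  apply/measurable_EFinP; apply: measurable_funM; first apply: measurable_funM.
  - exact: (measurableT_comp mI measurable_fst).
  - apply: measurable_funX; apply: measurableT_comp.
      exact: measurable_miss_prob.
    by apply: measurableT_comp => //; exact: measurable_fst.
  - apply: measurableT_comp; first exact: measurable_indic (measurableC mD).
    apply: measurable_funD; last exact: measurable_snd.
    by apply: measurableT_comp => //; exact: measurable_fst.
have f0 p : (0 <= f p)%E by rewrite lee_fin !mulr_ge0 ?exprn_ge0 ?miss_prob_ge0.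
have := ge0_integral_sigma_rectangles indep (uniq_past k.+1 j)
  (_ : inr j \notin past k.+1 j) (HW j) mf f0.
rewrite inr_past ltnn => /(_ isT) E.
transitivity (\int[P]_w f (w, W j w))%E.
  by apply: eq_integral => w _; rewrite indic_avoidsS mulrAC.
rewrite {}E; apply: eq_integral => w _; rewrite /f /=.
(* For fixed [w] only the last indicator depends on [y]; its [nu]-integral is the extra factor
   [miss_prob (X k w)]. *)
under eq_integral do rewrite EFinM.
have mA : measurable [set y | (~` D) (X k w + y)].
  by apply: measurable_translate; exact: measurableC.
rewrite ge0_integralZl//=.
- rewrite (_ : (fun y => _) =
    EFin \o \1_([set y | (~` D) (X k w + y)])) ?integral_indic//.
  by rewrite setIT -[X in (_ * X)%E]miss_probE -EFinM exprSr mulrA.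
- apply/measurable_EFinP.
  have := measurable_indic mA; exact.
- by rewrite lee_fin mulr_ge0 ?exprn_ge0 ?miss_prob_ge0.
Qed.

(** Induction on the number [i] of sums of block [k] restored to the event: each costs one factor
    [miss_prob]. At [i = M] no factor is left. *)
Lemma integrate_out_block k i : (i <= M)%N ->
  (\int[P]_w (\1_(avoids (k * M)) w * miss_prob (X k w) ^+ M)%:E =
   \int[P]_w (\1_(avoids (k * M + i)) w * miss_prob (X k w) ^+ (M - i))%:E)%E.
Proof.
elim: i => [|i IH] iM; first by rewrite addn0 subn0.
have kE : ((k * M + i) %/ M)%N = k by rewrite divnMDl// divn_small ?addn0.
rewrite IH 1?ltnW// addnS.
by have := integrate_out_noise (k * M + i) (M - i.+1); rewrite kE subnSK.
Qed.

(* By conditional independence given [X k], the probability that the whole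
   [k]-th block avoids [D]. *)
Definition block_prob : \bar R := (\int[mu]_x (miss_prob x ^+ M)%:E)%E.

Lemma probability_avoids_block k :
  P (avoids (k.+1 * M)) = (P (avoids (k * M)) * block_prob)%E.
Proof.
have -> : P (avoids (k.+1 * M)) = (\int[P]_w (\1_(avoids (k.+1 * M)) w)%:E)%E.
  by rewrite integral_indic// ?setIT//; exact: measurable_avoids.
transitivity (\int[P]_w (\1_(avoids (k * M)) w * miss_prob (X k w) ^+ M)%:E)%E.
  rewrite (integrate_out_block _ (leqnn M)) subnn mulSnr.
  by apply: eq_integral => w _; rewrite expr0 mulr1.
(* With the noise of block [k] gone, [X k] is itself the fresh variable: the earlier blocks involve
   only [X i] with [i < k]. *)
pose f (p : sigma_past k (k * M) * R) : \bar R :=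
  (\1_(avoids (k * M)) p.1 * miss_prob p.2 ^+ M)%:E.
have mh : measurable_fun setT (fun x => miss_prob x ^+ M).
  by apply: measurable_funX; exact: measurable_miss_prob.
have mI : measurable_fun (setT : set (sigma_past k (k * M)))
    (\1_(avoids (k * M)) : sigma_past k (k * M) -> R).
  exact: measurable_indic (past_avoids (leqnn _)).
have mf : measurable_fun setT f.
  apply/measurable_EFinP; apply: measurable_funM.
  - exact: (measurableT_comp mI measurable_fst).
  - by apply: (measurableT_comp mh); exact: measurable_snd.
have f0 p : (0 <= f p)%E by rewrite lee_fin mulr_ge0 ?exprn_ge0 ?miss_prob_ge0.
have := ge0_integral_sigma_rectangles indep (uniq_past k (k * M))
  (_ : inl k \notin past k (k * M)) (HX k) mf f0.
rewrite inl_past ltnn => /(_ isT) /= ->; rewrite /f /=.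
transitivity (\int[P]_w ((\1_(avoids (k * M)) w)%:E * block_prob))%E.
  apply: eq_integral => w _; under eq_integral do rewrite EFinM.
  rewrite ge0_integralZl//; first exact/measurable_EFinP.
  by move=> x _; rewrite lee_fin exprn_ge0// miss_prob_ge0.
have mA := measurable_avoids (k * M).
rewrite ge0_integralZr//.
- by rewrite integral_indic// setIT.
- by apply/measurable_EFinP; exact: measurable_indic.
- by apply: integral_ge0 => x _; rewrite lee_fin exprn_ge0// miss_prob_ge0.
Qed.

Lemma probability_avoids n : P (avoids (n * M)) = (block_prob ^+ n)%E.
Proof.
elim: n => [|n IH].
  by rewrite mul0n /avoids II0 bigcap_set0 probability_setT expe0.
by rewrite probability_avoids_block IH muleC expeS.
Qed.

End avoidance.

(** * Elementary inequalities and the exponential limit *)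

Lemma expr_onem_ge (R : realDomainType) (g : R) (m : nat) :
  0 <= g <= 1 -> 1 - m%:R * g <= (1 - g) ^+ m.
Proof.
move=> /andP[g0 g1]; elim: m => [|m IH]; first by rewrite mul0r subr0 expr0.
rewrite exprS -natr1.
apply: (@le_trans _ _ ((1 - g) * (1 - m%:R * g))).
  by have : 0 <= m%:R :> R by []; nra.
by rewrite ler_wpM2l ?subr_ge0.
Qed.

Lemma expr_onem_le (R : realDomainType) (g : R) (m : nat) :
  0 <= g <= 1 -> (1 - g) ^+ m <= 1 - m%:R * g + m%:R ^+ 2 * g ^+ 2.
Proof.
move=> /andP[g0 g1]; elim: m => [|m IH].
  by rewrite mul0r subr0 expr0 lerDl; nra.
rewrite exprS -natr1.
apply: (@le_trans _ _ ((1 - g) * (1 - m%:R * g + m%:R ^+ 2 * g ^+ 2))).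
  by rewrite ler_wpM2l ?subr_ge0.
have m0 : 0 <= m%:R :> R by [].
(* The gap to be shown nonnegative is [g^2 + m g^2 + m^2 g^3]. *)
have : 0 <= m%:R * g ^+ 2 by rewrite mulr_ge0 ?exprn_ge0.
have : 0 <= m%:R ^+ 2 * g ^+ 3 by rewrite mulr_ge0 ?exprn_ge0.
by nra.
Qed.

(** Two uses of [1 + x <= expR x], at [x = u - 1] and [x = (1 - u) / u], give [expR (- (1 - u) / u)
    <= u <= expR (- (1 - u))] for [u > 0]. The n-th powers squeeze, since [u n] tends to 1. *)
Lemma cvg_expr_expR (R : realType) (u : nat -> R) (tau : R) :
  (forall n, 0 <= u n <= 1) ->
  (fun n => n%:R * (1 - u n)) @ \oo --> tau ->
  (fun n => u n ^+ n) @ \oo --> expR (- tau).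
Proof.
move=> u01 nu_tau.
have u1 : u @ \oo --> (1 : R).
  (* The index is shifted so that the division is never by zero. *)
  have : (fun n => 1 - (n.+1%:R * (1 - u n.+1)) * n.+1%:R^-1) @ \oo
      --> 1 - tau * 0.
    apply: cvgB; first exact: cvg_cst.
    apply: cvgM; last exact: cvg_harmonic.
    by move: nu_tau; rewrite -cvg_shiftS.
  rewrite mulr0 subr0 => H; rewrite -cvg_shiftS; apply: cvg_trans H.
  apply: near_eq_cvg; near=> n.
  by rewrite mulrAC divff ?mul1r ?pnatr_eq0// opprB addrC subrK.
have lo : (fun n => expR (- (n%:R * (1 - u n) / u n))) @ \oo --> expR (- tau).
  apply: continuous_cvg; first exact: continuous_expR.
  apply: cvgN; rewrite -[X in _ --> X]divr1.
  by apply: cvgM => //; apply: cvgV.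
have hi : (fun n => expR (- (n%:R * (1 - u n)))) @ \oo --> expR (- tau).
  apply: continuous_cvg; first exact: continuous_expR.
  exact: cvgN.
apply: squeeze_cvgr lo hi; near=> n.
have /andP[un0 un1] := u01 n.
have un : 0 < u n by near: n; apply: (cvgr_gt _ u1); exact: ltr01.
apply/andP; split.
  rewrite -mulrA -mulrN mulrC expRM_natr.
  apply: lerXn2r; rewrite ?nnegrE ?expR_ge0//.
  rewrite expRN invf_ple ?posrE ?expR_gt0//.
  apply: le_trans (expR_ge1Dx _).
  by rewrite mulrBl mul1r divff ?gt_eqF// addrC subrK.
rewrite -mulrN mulrC expRM_natr.
apply: lerXn2r; rewrite ?nnegrE ?expR_ge0//.
by apply: le_trans (expR_ge1Dx _); lra.
Unshelve. all: by end_near.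
Qed.

(** * Two-sided bounds on the block probability *)

Section block_prob_bounds.
Context (R : realType) (mu nu : probability R R) (M : nat) (D : set R)
  (mD : measurable D).
Let h := miss_prob nu D.
Let s := ereal_sup [set nu ((fun b => b + x) @` D) | x in [set: R]].
Let p := convolution mu nu D.

Lemma onem_miss_probE (x : R) : (1 - h x)%:E = nu [set y | D (x + y)].
Proof.
have mE := measurable_translate x (measurableC mD).
have -> : [set y | D (x + y)] = ~` [set y | (~` D) (x + y)].
  by apply/seteqP; split=> y /=; [move=> Dy; apply|exact: contrapT].
by rewrite probability_setC// EFinB /h miss_probE.
Qed.

Lemma miss_prob_le1 (x : R) : h x <= 1.
Proof. by rewrite -subr_ge0 -lee_fin onem_miss_probE. Qed.

Lemma measurable_onem_miss_prob : measurable_fun setT (fun x => 1 - h x).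
Proof. by apply: measurable_funB => //; exact: measurable_miss_prob. Qed.

(** The product measure is by construction the [mu]-integral of the [nu]-measures of the
    sections. *)
Lemma integral_onem_miss_prob : (\int[mu]_x (1 - h x)%:E = p)%E.
Proof.
rewrite /p /convolution /product_measure1 /=; apply: eq_integral => x _.
rewrite onem_miss_probE; congr (nu _); rewrite /xsection.
by apply/seteqP; split=> y /=; rewrite in_setE /= in_setE.
Qed.

Lemma onem_miss_prob_le_sup (x : R) : ((1 - h x)%:E <= s)%E.
Proof.
(* The set of [y] with [x + y] in [D] is the translate of [D] by [- x]. *)
rewrite onem_miss_probE; apply: ereal_sup_ubound; exists (- x) => //.
congr (nu _); apply/seteqP; split=> [_ [b Db <-] /=|y /= Dxy].
  by rewrite addrC subrK.
by exists (x + y) => //; rewrite addrC addKr.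
Qed.

Lemma sup_fin_num : s \is a fin_num.
Proof.
rewrite ge0_fin_numE; last first.
  by apply: le_trans (onem_miss_prob_le_sup 0); rewrite onem_miss_probE.
apply: (@le_lt_trans _ _ 1%E); last exact: ltry.
apply: ge_ereal_sup => _ [x _ <-]; apply: probability_le1.
(* Measurability of the translate is seen by writing this image as a preimage. *)
rewrite (_ : _ @` _ = [set y | D (- x + y)]).
  exact: measurable_translate.
apply/seteqP; split=> [_ [b Db <-] /=|y /= Dxy].
  by rewrite addrC addrK.
by exists (- x + y) => //; rewrite addrC addNKr.
Qed.

Let integral_one : (\int[mu]_x cst 1 x = 1)%E.
Proof. by rewrite integral_cst// mul1e; exact: probability_setT. Qed.

Lemma convolution_fin_num : p \is a fin_num.
Proof.
rewrite -integral_onem_miss_prob ge0_fin_numE; last first.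
  by apply: integral_ge0 => x _; rewrite onem_miss_probE.
apply: (@le_lt_trans _ _ (\int[mu]_x cst 1%E x)%E); last first.
  by rewrite integral_one ltry.
apply: ge0_le_integral => //.
- by move=> x _; rewrite onem_miss_probE.
- by apply/measurable_EFinP; exact: measurable_onem_miss_prob.
- by move=> x _; rewrite lee_fin gerBl miss_prob_ge0.
Qed.

Let measurable_miss_probX : measurable_fun setT (fun x => (h x ^+ M)%:E).
Proof.
by apply/measurable_EFinP; apply: measurable_funX; exact: measurable_miss_prob.
Qed.

Lemma block_prob_ge0 : (0 <= block_prob mu nu M D)%E.
Proof.
by apply: integral_ge0 => x _; rewrite lee_fin exprn_ge0// miss_prob_ge0.
Qed.

Lemma block_prob_le1 : (block_prob mu nu M D <= 1)%E.
Proof.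
apply: (@le_trans _ _ (\int[mu]_x cst 1%E x)%E); last first.
  by rewrite integral_one.
apply: ge0_le_integral => //.
- by move=> x _; rewrite lee_fin exprn_ge0// miss_prob_ge0.
- by move=> x _; rewrite lee_fin exprn_ile1// ?miss_prob_ge0// miss_prob_le1.
Qed.

Lemma block_prob_fin_num : block_prob mu nu M D \is a fin_num.
Proof.
rewrite ge0_fin_numE ?block_prob_ge0//.
by rewrite (le_lt_trans block_prob_le1)// ltry.
Qed.

Let integral_affine (c : R) : 0 <= c ->
  (\int[mu]_x (c * (1 - h x))%:E = (c * fine p)%:E)%E.
Proof.
move=> c0; under eq_integral do rewrite EFinM.
rewrite ge0_integralZl//.
- by rewrite integral_onem_miss_prob EFinM fineK// convolution_fin_num.
- by apply/measurable_EFinP; exact: measurable_onem_miss_prob.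
- by move=> x _; rewrite onem_miss_probE.
Qed.

Let measurable_affine (c : R) : measurable_fun setT (fun x => (c * (1 - h x))%:E).
Proof.
apply/measurable_EFinP; apply: measurable_funM => //.
exact: measurable_onem_miss_prob.
Qed.

Let affine_ge0 (c x : R) : 0 <= c -> (0 <= (c * (1 - h x))%:E)%E.
Proof. by move=> c0; rewrite lee_fin mulr_ge0// subr_ge0 miss_prob_le1. Qed.

(** Both bounds are proved for this sum: keeping [M g] beside [h^M] leaves only nonnegative
    integrands, with no subtraction of integrals. *)
Let sum_integral :
  (\int[mu]_x ((h x ^+ M)%:E + (M%:R * (1 - h x))%:E) =
   (fine (block_prob mu nu M D) + M%:R * fine p)%:E)%E.
Proof.
rewrite ge0_integralD//.
- by rewrite integral_affine// EFinD fineK// block_prob_fin_num.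
- by move=> x _; rewrite lee_fin exprn_ge0// miss_prob_ge0.
- by move=> x _; exact: affine_ge0.
Qed.

(** Integrate [expr_onem_ge] at [g = 1 - h x], in the form [1 <= h^M + M g]. *)
Lemma block_prob_lower :
  1 - fine (block_prob mu nu M D) <= M%:R * fine p.
Proof.
rewrite lerBlDl -lee_fin -sum_integral.
apply: (@le_trans _ _ (\int[mu]_x cst 1%E x)%E).
  by rewrite integral_one.
apply: ge0_le_integral => //.
- exact: (emeasurable_funD measurable_miss_probX (measurable_affine _)).
- move=> x _; rewrite -EFinD lee_fin -lerBlDr.
  have := @expr_onem_ge R (1 - h x) M; rewrite subKr; apply.
  by rewrite subr_ge0 miss_prob_le1 gerBl miss_prob_ge0.
Qed.

Lemma block_prob_upper :
  M%:R * fine p - M%:R ^+ 2 * fine s * fine p <=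
  1 - fine (block_prob mu nu M D).
Proof.
have s0 : 0 <= fine s.
  apply: fine_ge0.
  by apply: le_trans (onem_miss_prob_le_sup 0); rewrite onem_miss_probE.
have c0 : 0 <= M%:R ^+ 2 * fine s by rewrite mulr_ge0 ?exprn_ge0.
suff : fine (block_prob mu nu M D) + M%:R * fine p <=
    1 + M%:R ^+ 2 * fine s * fine p by lra.
rewrite -lee_fin -sum_integral.
apply: (@le_trans _ _
  (\int[mu]_x (1 + (M%:R ^+ 2 * fine s * (1 - h x))%:E))%E); last first.
  rewrite ge0_integralD//; last by move=> x _; exact: affine_ge0.
  by rewrite integral_affine// integral_one EFinD.
apply: ge0_le_integral => //.
- by move=> x _; rewrite adde_ge0 ?affine_ge0// lee_fin exprn_ge0// miss_prob_ge0.
- exact: (emeasurable_funD measurable_miss_probX (measurable_affine _)).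
- exact: (emeasurable_funD (measurable_cst _) (measurable_affine _)).
- move=> x _; rewrite -!EFinD lee_fin.
  have h0 : 0 <= 1 - h x by rewrite subr_ge0 miss_prob_le1.
  have := @expr_onem_le R (1 - h x) M; rewrite subKr.
  rewrite h0 gerBl miss_prob_ge0 => /(_ isT) hM.
  have hs : 1 - h x <= fine s.
    by rewrite -lee_fin fineK ?sup_fin_num//; exact: onem_miss_prob_le_sup.
  (* One factor of [g^2] is bounded by the supremum; the other is kept and integrates to [p]. *)
  have : M%:R ^+ 2 * (1 - h x) ^+ 2 <= M%:R ^+ 2 * fine s * (1 - h x).
    by rewrite -mulrA ler_wpM2l ?exprn_ge0// expr2 ler_wpM2r.
  by move: hM; lra.
Qed.

End block_prob_bounds.

(** * Passage to the limit along the multiples of M *)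

Theorem theorem34 (R : realType) (d : measure_display) (T : measurableType d)
  (P : probability T R) (mu nu : probability R R)
  (X W : nat -> {RV P >-> R})
  (HX : forall k, has_law (X k) mu)
  (HW : forall j, has_law (W j) nu)
  (Hindep : mutually_independent
              (fun i : nat + nat => match i with inl k => X k | inr j => W j end))
  (M : nat) (HM : (0 < M)%N)
  (B : nat -> set R) (HB : forall n, measurable (B n))
  (tau : R) (Htau : 0 <= tau)
  (Hsup : (fun n => ereal_sup [set nu ((fun b => b + x) @` B n) | x in [set: R]])
            @ \oo --> 0%E)
  (Hconv : (fun n : nat => (n%:R)%:E * convolution mu nu (B n))%E @ \oo --> tau%:E) :
  let Y := fun (j : nat) (w : T) => X (j %/ M)%N w + W j w in
  (fun n : nat => P [set w | forall i : nat, (i < n * M)%N -> Y i w \notin B (n * M)%N])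
    @ \oo --> (expR (- tau))%:E.
Proof.
move=> Y.
pose u n := fine (block_prob mu nu M (B (n * M)%N)).
pose p n := fine (convolution mu nu (B (n * M)%N)).
pose s n := fine (ereal_sup [set nu ((fun b => b + x) @` B (n * M)%N) | x in [set: R]]).
(* Since [M > 0], [n * M] tends to infinity, so both hypotheses can be read along this
   subsequence. *)
have sub (f : nat -> R) (l : R) : f @ \oo --> l -> (fun n => f (n * M)%N) @ \oo --> l.
  by move=> fl; exact: (cvg_comp (fun n => n * M)%N f (@cvg_mulnr M HM) fl).
have s_0 : s @ \oo --> (0 : R) by exact: (sub _ _ (fine_cvg Hsup)).
have p_tau : (fun n => n%:R * M%:R * p n) @ \oo --> tau.
  rewrite (_ : (fun n => _) = (fun n => fine ((n * M)%:R%:E *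
    convolution mu nu (B (n * M)%N))%E)); last first.
    by apply/funext => n; rewrite fineM//= ?natrM// convolution_fin_num.
  exact: (sub _ _ (fine_cvg Hconv)).
(* This is [n] times the bound of [block_prob_upper], factored; the correction vanishes because
   [s n] tends to 0. *)
have lower_tau : (fun n => n%:R * M%:R * p n * (1 - M%:R * s n)) @ \oo --> tau.
  rewrite -[X in _ --> X]mulr1 -[X in _ * X]subr0 -[X in _ - X](mulr0 M%:R).
  apply: cvgM => //; apply: cvgB; first exact: cvg_cst.
  by apply: cvgM => //; exact: cvg_cst.
have u_tau : (fun n => n%:R * (1 - u n)) @ \oo --> tau.
  apply: squeeze_cvgr lower_tau p_tau; apply: nearW => n.
  have mB := HB (n * M)%N.
  have lo := block_prob_upper mu nu M mB.
  have hi := block_prob_lower mu nu M mB.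
  apply/andP; split; last by rewrite -mulrA ler_wpM2l.
  apply: le_trans (ler_wpM2l (ler0n R n) lo).
  by rewrite -/(p n) -/(s n); lra.
have u01 n : 0 <= u n <= 1.
  rewrite fine_ge0 ?block_prob_ge0//=.
  by rewrite -lee_fin fineK ?block_prob_fin_num// block_prob_le1.
have uE n : P [set w | forall i, (i < n * M)%N -> Y i w \notin B (n * M)%N] =
    (u n ^+ n)%:E.
  rewrite EFin_expe fineK ?block_prob_fin_num//.
  rewrite -(probability_avoids HX HW Hindep HM (HB (n * M)%N)).
  congr (P _); apply/seteqP; split=> w /= Bw i ij.
    by have := Bw i ij; rewrite notin_setE.
  by rewrite notin_setE; exact: Bw.
under eq_fun do rewrite uE.
apply: cvg_EFin; first exact: nearW.
exact: cvg_expr_expR.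
Qed.
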